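(* Let $(M,F)$ be a Finsler manifold admitting a concurrent $\pi$-vector field $\overline{\varphi}$ with associated $\pi$-form $\phi=i_{\overline{\varphi}}g$, and let $\Phi=\phi(\overline{\eta})$. Let $\widehat F=\frac{F^2}{F-\Phi}$ on $\mathcal D=\{(x,y)\in TM : F(x,y)>\Phi(x,y)\}$ be a generalized $\phi$-Matsumoto metric (that is, assume $\widehat F$ is a conic pseudo-Finsler structure on $M$). Then the metric tensor $\widehat g$ of $\widehat F$ is given on $\mathcal D$, for all $\pi$-vector fields $\overline W,\overline Z$, by $$\widehat g(\overline W,\overline Z)=\frac{F^2(F-2\Phi)}{(F-\Phi)^3}g(\overline W,\overline Z)+\frac{3F^4}{(F-\Phi)^4}\phi(\overline W)\phi(\overline Z)+\frac{F^2\Phi(4\Phi-F)}{(F-\Phi)^4}\ell(\overline W)\ell(\overline Z)+\frac{F^3(F-4\Phi)}{(F-\Phi)^4}\left\{\phi(\overline W)\ell(\overline Z)+\phi(\overline Z)\ell(\overline W)\right\}.$$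
   Context: Setting. $M$ is an $n$-dimensional paracompact smooth manifold, $\pi:TM\to M$ its tangent bundle, $\mathcal TM=TM\setminus\{0\}$ the slit tangent bundle. $\pi$-vector fields are smooth sections of the pullback of the bundle $TM\to M$ over $\mathcal TM$ (local basis $\overline{\partial}_i$); $\pi$-forms/tensors are the corresponding (dual) tensor sections. $\gamma$ is the natural injection (vertical lift) $\gamma(W^i\overline\partial_i)=W^i\partial_{y^i}$, $\rho(a^i\partial_{x^i}+b^i\partial_{y^i})=a^i\overline\partial_i$, $J=\gamma\circ\rho$, $\overline\eta(u)=(u,u)$ (i.e. $\overline\eta=y^i\overline\partial_i$), $\mathcal C=\gamma\overline\eta$, and $d_Jf=df\circ J$ for functions $f$. Finsler structure: $F:TM\to[0,\infty)$, $C^\infty$ on $\mathcal TM$, $C^0$ on $TM$, positively homogeneous of degree 1 in $y$, with $dd_JE$ of maximal rank, $E=\frac12F^2$. Metric tensor: $g(\rho W,\rho Z)=dd_JE(JW,Z)$ (it is positive definite). Supporting form $\ell=F^{-1}i_{\overline\eta}g$. Geodesic spray $G$: $JG=\mathcal C$, $[\mathcal C,G]=G$, $i_Gdd_JE=-dE$. Barthel connection $\Gamma=[J,G]$ (i.e. $\Gamma X=[JX,G]-J[X,G]$), projectors $h=\frac12(I+\Gamma)$, $v=\frac12(I-\Gamma)$, horizontal map $\beta=(\rho|_{\mathrm{Im}\,h})^{-1}$. Berwald connection $D^\circ$: $\gamma D^\circ_{hZ}\rho W=v[hZ,JW]$, $D^\circ_{\gamma\overline Z}\overline W=\rho[\gamma\overline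 Z,\beta\overline W]$. Cartan connection $\nabla$: determined by $2g(\nabla_{\gamma\overline X}\overline Y,\overline Z)=\gamma\overline X\cdot g(\overline Y,\overline Z)+g(\overline Y,\rho[\beta\overline Z,\gamma\overline X])+g(\overline Z,\rho[\gamma\overline X,\beta\overline Y])$ and $2g(\nabla_{\beta\overline X}\overline Y,\overline Z)=\beta\overline X\cdot g(\overline Y,\overline Z)+\beta\overline Y\cdot g(\overline Z,\overline X)-\beta\overline Z\cdot g(\overline X,\overline Y)-g(\overline X,\rho[\beta\overline Y,\beta\overline Z])+g(\overline Y,\rho[\beta\overline Z,\beta\overline X])+g(\overline Z,\rho[\beta\overline X,\beta\overline Y])$. Concurrent $\pi$-vector field: a non-vanishing $\pi$-vector field $\overline\varphi$ with $\nabla_{\beta\overline W}\overline\varphi=-\overline W=D^\circ_{\beta\overline W}\overline\varphi$ and $\nabla_{\gamma\overline W}\overline\varphi=0=D^\circ_{\gamma\overline W}\overline\varphi$ for all $\overline W$. Conic pseudo-Finsler structure on $M$: a smooth function to $[0,\infty)$ on a conic sub-bundle $\mathcal D\subset\mathcal TM$ (non-empty, open, invariant under scaling by positive reals, $\pi(\mathcal D)=M$, each fibre $\mathcal D_x$ connected), positively 1-homogeneous in $y$, whose form $dd_J(\frac12(\cdot)^2)$ has maximal rank. Its metric tensor is defined on $\mathcal D$ by $\widehat g(\rho W,\rho Z)=dd_J\widehat E(JW,Z)$ with $\widehat E=\frac12\widehat F^2$. *)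

(* Defs.v *)
From HB Require Import structures.
From mathcomp Require Import all_boot all_order all_algebra.
From mathcomp Require Import all_classical all_reals all_analysis.

Set Implicit Arguments.
Unset Strict Implicit.
Unset Printing Implicit Defensive.

Import Order.TTheory GRing.Theory Num.Theory.
Import numFieldNormedType.Exports.

Local Open Scope classical_set_scope.
Local Open Scope ring_scope.

Section Calculus.
Context {R : realType}.

(* Only meaningful for U open: every condition refers to full neighbourhoods. *)
Fixpoint Ck {V W : normedModType R} (k : nat) (U : set V) (f : V -> W) : Prop :=
  match k with
  | 0%N => forall p, U p -> {for p, continuous f}
  | k'.+1 => (forall p, U p -> differentiable f p) /\
             (forall v, Ck k' U (fun p => 'D_v f p))
  end.

Definition smooth_on {V W : normedModType R} (U : set V) (f : V -> W) : Prop :=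
  forall k, Ck k U f.

(* Vector fields on a normed space are maps X : V -> V, acting on functions by
   X . f = D_X f. *)
Definition lie_bracket {V : normedModType R} (X Y : V -> V) : V -> V :=
  fun p => 'D_(X p) Y p - 'D_(Y p) X p.

(* d omega (A, B) = A . omega(B) - B . omega(A) - omega([A, B]) for the constant
   vector fields A = a, B = b, whose bracket vanishes. *)
Definition ext_d {V : normedModType R} (omega : V -> V -> R) (p a b : V) : R :=
  'D_a (fun q => omega q b) p - 'D_b (fun q => omega q a) p.

End Calculus.

Definition paracompact (T : topologicalType) : Prop :=
  forall A : set (set T),
    (forall O, A O -> open O) -> \bigcup_(O in A) O = setT ->
    exists B : set (set T),
      [/\ forall O, B O -> open O,
          \bigcup_(O in B) O = setT,
          forall O, B O -> exists2 O', A O' & O `<=` O'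
        & forall x : T, exists2 N, nbhs x N &
            finite_set [set O | B O /\ O `&` N !=set0] ].

(* cinv c is the inverse of cmap c on the open set cmap c @` dom c and
   unconstrained elsewhere.  chart_at selects one chart around each point; it
   only serves to give tangent vectors a concrete representation. *)
Record manifold (R : realType) (n : nat) := Manifold {
  carrier :> topologicalType;
  manifold_hausdorff : hausdorff_space carrier;
  manifold_paracompact : paracompact carrier;
  chart : Type;
  dom : chart -> set carrier;
  cmap : chart -> carrier -> 'rV[R]_n;
  cinv : chart -> 'rV[R]_n -> carrier;
  chart_at : carrier -> chart;
  dom_chart_at : forall x, dom (chart_at x) x;
  dom_open : forall c, open (dom c);
  codom_open : forall c, open (cmap c @` dom c);
  cmapK : forall c x, dom c x -> cinv c (cmap c x) = x;
  cmap_continuous : forall c x, dom c x -> {for x, continuous (cmap c)};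
  cinv_continuous : forall c p, (cmap c @` dom c) p ->
    {for p, continuous (cinv c)};
  transition_smooth : forall c d,
    smooth_on (cmap c @` (dom c `&` dom d)) (cmap d \o cinv c)
}.

Section TangentBundle.
Context {R : realType} {n : nat}.
Variable M : manifold R n.

(* A tangent vector at x is represented by its components in chart_at x, so
   every tangent space T_x M is 'rV[R]_n; the topology and smooth structure of
   TM are read in the natural charts (x^i, y^i) below. *)
Record TM := TVec { base : M; vec : 'rV[R]_n }.

Definition slit : set TM := [set u | vec u != 0].

Definition vcoord (c : chart M) (x : M) (v : 'rV[R]_n) : 'rV[R]_n :=
  'D_v (cmap c \o cinv (chart_at x)) (cmap (chart_at x) x).

(* (x^i, y^i) in the natural chart of TM over c, and the inverse of this
   chart. *)
Definition tcoord (c : chart M) (u : TM) : 'rV[R]_n * 'rV[R]_n :=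
  (cmap c (base u), vcoord c (base u) (vec u)).

Definition tpoint (c : chart M) (p : 'rV[R]_n * 'rV[R]_n) : TM :=
  let x := cinv c p.1 in
  TVec x ('D_(p.2) (cmap (chart_at x) \o cinv c) p.1).

Definition tdom (c : chart M) (D : set TM) : set ('rV[R]_n * 'rV[R]_n) :=
  [set p | (cmap c @` dom c) p.1 /\ D (tpoint c p)].

Definition TM_open (D : set TM) : Prop := forall c, open (tdom c D).

Definition TM_continuous (f : TM -> R) : Prop :=
  forall c p, tdom c setT p -> {for p, continuous (f \o tpoint c)}.

Definition TM_smooth (D : set TM) (f : TM -> R) : Prop :=
  forall c, smooth_on (tdom c D) (f \o tpoint c).

(* pi-vector fields: W u belongs to the tangent space at base u. *)
Definition pi_field : Type := TM -> 'rV[R]_n.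

Definition pi_local (W : pi_field) (c : chart M) :
    'rV[R]_n * 'rV[R]_n -> 'rV[R]_n :=
  fun p => vcoord c (base (tpoint c p)) (W (tpoint c p)).

Definition pi_smooth (W : pi_field) : Prop :=
  forall c, smooth_on (tdom c slit) (pi_local W c).

End TangentBundle.

(* Geometry of the slit tangent bundle read in a natural chart: V stands for the
   (x^i, y^i)-space, a vector field a^i d/dx^i + b^i d/dy^i is the map (a, b)
   from V to V, a pi-vector field W^i dbar_i is the map W from V to 'rV_n, and U
   is the part of V corresponding to the slit tangent bundle. *)
Section NaturalChart.
Context {R : realType} {n : nat}.
Local Notation X := 'rV[R]_n.
Local Notation V := ('rV[R]_n * 'rV[R]_n)%type.
Implicit Types (U : set V) (E : V -> R) (Z G : V -> V) (W Y : V -> X).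

Definition gam W : V -> V := fun p => (0, W p).
Definition rho Z : V -> X := fun p => (Z p).1.
Definition vertJ Z : V -> V := gam (rho Z).
Definition eta : V -> X := fun p => p.2.
Definition liouville : V -> V := gam eta.

(* d_J E = dE o J, and the 2-form d d_J E. *)
Definition dJ E : V -> V -> R := fun p a => 'D_((0, a.1) : V) E p.
Definition ddJ E : V -> V -> V -> R := ext_d (dJ E).

Definition max_rank U E : Prop :=
  forall p, U p -> forall a, (forall b, ddJ E p a b = 0) -> a = 0.

(* g(rho A, rho B) = dd_J E(J A, B), with the lifts A = (a, 0), B = (b, 0) of
   a and b; dd_J E vanishes on pairs of vertical vectors, so that the choice of
   the lift is immaterial. *)
Definition metric E (p : V) (a b : X) : R := ddJ E p (0, a) (b, 0).

Definition is_spray U E G : Prop :=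
  smooth_on U G /\
  forall p, U p ->
    [/\ vertJ G p = liouville p,
        lie_bracket liouville G p = G p
      & forall b, ddJ E p (G p) b = - 'D_b E p].

Definition barthel G Z : V -> V :=
  fun p => lie_bracket (vertJ Z) G p - vertJ (lie_bracket Z G) p.
Definition hproj G Z : V -> V := fun p => 2^-1 *: (Z p + barthel G Z p).
Definition vproj G Z : V -> V := fun p => 2^-1 *: (Z p - barthel G Z p).

(* The horizontal map (rho | Im h)^-1: beta W p is the unique vector of the
   form (h Z)(p) that rho maps to W p. *)
Definition beta U G W : V -> V := fun p =>
  xget 0 [set b | b.1 = W p /\ exists2 Z, smooth_on U Z & b = hproj G Z p].

(* D_{gam W} Y and D_{beta W} Y for the Berwald connection.  In
   gam D_{hZ}(rho A) = v[hZ, JA], hZ = beta (rho Z), JA = gam (rho A), and gam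
   is inverted by the second component. *)
Definition berwald_v U G W Y : V -> X :=
  rho (lie_bracket (gam W) (beta U G Y)).
Definition berwald_h U G W Y : V -> X :=
  fun p => (vproj G (lie_bracket (beta U G W) (gam Y)) p).2.

(* nab A Y is the covariant derivative of Y in the direction of the vector
   field A. *)
Definition is_cartan U E G (nab : (V -> V) -> (V -> X) -> V -> X) : Prop :=
  let g (Y1 Y2 : V -> X) : V -> R := fun p => metric E p (Y1 p) (Y2 p) in
  let br (A B : V -> V) : V -> X := rho (lie_bracket A B) in
  let b := beta U G in
  forall W Y Z : V -> X, smooth_on U W -> smooth_on U Y -> smooth_on U Z ->
  forall p, U p ->
    2 * g (nab (gam W) Y) Z p =
      'D_(gam W p) (g Y Z) p + g Y (br (b Z) (gam W)) p
      + g Z (br (gam W) (b Y)) p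
    /\
    2 * g (nab (b W) Y) Z p =
      'D_(b W p) (g Y Z) p + 'D_(b Y p) (g Z W) p - 'D_(b Z p) (g W Y) p
      - g W (br (b Y) (b Z)) p + g Y (br (b Z) (b W)) p
      + g Z (br (b W) (b Y)) p.

Definition concurrent_on U G (nab : (V -> V) -> (V -> X) -> V -> X)
    (phi : V -> X) : Prop :=
  forall W : V -> X, smooth_on U W -> forall p, U p ->
    [/\ nab (beta U G W) phi p = - W p,
        berwald_h U G W phi p = - W p,
        nab (gam W) phi p = 0
      & berwald_v U G W phi p = 0].

End NaturalChart.

Section Finsler.
Context {R : realType} {n : nat} {M : manifold R n}.
Local Notation X := 'rV[R]_n.
Local Notation V := ('rV[R]_n * 'rV[R]_n)%type.
Implicit Types (F : TM M -> R) (u : TM M).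

Definition energy F (c : chart M) : V -> R := fun p => F (tpoint c p) ^+ 2 / 2.

Definition homogeneous1 (D : set (TM M)) F : Prop :=
  forall (t : R) u, 0 < t -> D u -> F (TVec (base u) (t *: vec u)) = t * F u.

Record finsler F : Prop := {
  finsler_ge0 : forall u, 0 <= F u;
  finsler_smooth : TM_smooth (@slit _ _ M) F;
  finsler_continuous : TM_continuous F;
  finsler_homogeneous : homogeneous1 setT F;
  finsler_max_rank : forall c, max_rank (tdom c (@slit _ _ M)) (energy F c)
}.

Record conic_pseudo_finsler (D : set (TM M)) F : Prop := {
  conic_slit : D `<=` @slit _ _ M;
  conic_nonempty : D !=set0;
  conic_open : TM_open D;
  conic_scale : forall (t : R) u, 0 < t -> D u ->
    D (TVec (base u) (t *: vec u));
  conic_surj : forall x : M, exists2 u, D u & base u = x;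
  conic_connected : forall x : M, connected [set v : X | D (TVec x v)];
  conic_ge0 : forall u, D u -> 0 <= F u;
  conic_smooth : TM_smooth D F;
  conic_homogeneous : homogeneous1 D F;
  conic_max_rank : forall c, max_rank (tdom c D) (energy F c)
}.

(* The metric tensor at u of two vectors of the tangent space at base u. *)
Definition gmetric F u (a b : X) : R :=
  let c := chart_at (base u) in metric (energy F c) (tcoord c u) a b.

Definition ell F u (a : X) : R := (F u)^-1 * gmetric F u (vec u) a.

(* G c represents the spray in the natural chart over c.  Since dd_J E is
   nondegenerate G c is unique, so the representatives patch to a vector field
   on the slit tangent bundle. *)
Definition geodesic_spray F (G : chart M -> V -> V) : Prop :=
  forall c, is_spray (tdom c (@slit _ _ M)) (energy F c) (G c).

Definition cartan_connection F (G : chart M -> V -> V)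
    (nab : chart M -> (V -> V) -> (V -> X) -> V -> X) : Prop :=
  forall c, is_cartan (tdom c (@slit _ _ M)) (energy F c) (G c) (nab c).

(* Connections are local operators: the defining identities are tested on
   pi-vector fields defined over the domain of each natural chart. *)
Record concurrent (G : chart M -> V -> V)
    (nab : chart M -> (V -> V) -> (V -> X) -> V -> X) (phi : pi_field M) :
    Prop := {
  concurrent_smooth : pi_smooth phi;
  concurrent_neq0 : forall u, slit u -> phi u != 0;
  concurrent_eq : forall c,
    concurrent_on (tdom c (@slit _ _ M)) (G c) (nab c) (pi_local phi c)
}.

(* phi(W) for the associated pi-form, and Phi = phi(eta).  On the zero section,
   where the metric is not defined, the formula for Phi gives 0, the value of
   its continuous extension. *)
Definition piform F (phi : pi_field M) u (a : X) : R := gmetric F u (phi u) a.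
Definition Phi F (phi : pi_field M) : TM M -> R :=
  fun u => piform F phi u (vec u).

Definition matsumoto F (phi : pi_field M) : TM M -> R :=
  fun u => F u ^+ 2 / (F u - Phi F phi u).
Definition matsumoto_dom F (phi : pi_field M) : set (TM M) :=
  [set u | Phi F phi u < F u].

End Finsler.

(* Main.v *)
(* The metric tensor is the fibre Hessian of the energy, so everything happens
   in one tangent space T_x M, read in the chart chosen at x.  Writing beta W in
   a chart, the Berwald condition on vertical directions says that phi does not
   depend on y; the Cartan condition then says that the derivative in y of the
   1-form g(phi, .) vanishes.  Hence Phi is affine in y near each point, with
   derivative g(phi, .), and the Hessian of (F^2 / (F - Phi))^2 / 2 follows from
   dF = l and from the symmetry of second derivatives. *)
Require Import Defs.
From HB Require Import structures.
From mathcomp Require Import all_boot all_order all_algebra.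
From mathcomp Require Import all_classical all_reals all_analysis.
From mathcomp Require Import ring lra.

Set Implicit Arguments.
Unset Strict Implicit.
Unset Printing Implicit Defensive.

Import Order.TTheory GRing.Theory Num.Theory.
Import numFieldNormedType.Exports.

Local Open Scope classical_set_scope.
Local Open Scope ring_scope.

(** * Directional derivatives as one-variable derivatives along lines *)

Section Lines.
Context {R : realType} {V W : normedModType R}.

Lemma line_quotient (f : V -> W) (v a : V) (t : R) :
  (fun h : R => h^-1 *: (f (v + (h *: 1 + t) *: a) - f (v + t *: a)))
  = (fun h => h^-1 *: (f (h *: a + (v + t *: a)) - f (v + t *: a))).
Proof.
apply/funext => h; congr (_ *: (f _ - _)).
by rewrite -[h *: 1]/(h * 1) mulr1 scalerDl addrCA.
Qed.

Lemma derive_line (f : V -> W) (v a : V) (t : R) :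
  'D_1 (fun s : R => f (v + s *: a)) t = 'D_a f (v + t *: a).
Proof. by rewrite /derive /= line_quotient. Qed.

Lemma derivable_line (f : V -> W) (v a : V) (t : R) :
  derivable f (v + t *: a) a -> derivable (fun s : R => f (v + s *: a)) t 1.
Proof. by rewrite /derivable /= line_quotient. Qed.

End Lines.

Lemma open_near {R : realType} {V : normedModType R} (U : set V) (x : V) :
  open U -> U x -> \forall y \near x, U y.
Proof. by move=> Uo Ux; apply: open_nbhs_nbhs. Qed.

(** * Symmetry of second directional derivatives *)

Section Schwarz.
Context {R : realType} {V : normedModType R}.

Lemma mvt_line (f : V -> R) (v a : V) (h : R) : 0 <= h ->
  (forall s, 0 <= s <= h -> derivable f (v + s *: a) a) ->
  exists2 s, 0 <= s <= h & f (v + h *: a) - f v = h * 'D_a f (v + s *: a).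
Proof.
move=> h0 df.
have dl s : s \in `[0, h] ->
    is_derive s (1 : R) (fun t => f (v + t *: a)) ('D_a f (v + s *: a)).
  rewrite in_itv/= => sh; rewrite -derive_line; apply: derivableP.
  exact/derivable_line/df.
pose g (s : R) : R := f (v + s *: a); pose g' (s : R) : R := 'D_a f (v + s *: a).
have gd : forall s, s \in `]0, h[ -> is_derive s (1 : R) g (g' s).
  by move=> s sh; apply: dl; apply: subset_itv_oo_cc sh.
have gc : {within `[0, h], continuous g}.
  by apply: derivable_within_continuous => s /dl[].
have [s sh E] := MVT_segment h0 gd gc.
move: sh; rewrite in_itv/= => sh; exists s => //.
by move: E; rewrite /g /g' scale0r addr0 subr0 mulrC.
Qed.

Lemma translate_quotient (f : V -> R) (a b x : V) :
  (fun h : R => h^-1 *: (f (h *: a + x + b) - f (x + b)))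
  = (fun h => h^-1 *: (f (h *: a + (x + b)) - f (x + b))).
Proof. by apply/funext => h; rewrite addrA. Qed.

Lemma derive_translate (f : V -> R) (a b x : V) :
  'D_a (fun y => f (y + b)) x = 'D_a f (x + b).
Proof. by rewrite /derive /= translate_quotient. Qed.

Lemma derivable_translate (f : V -> R) (a b x : V) :
  derivable f (x + b) a -> derivable (fun y => f (y + b)) x a.
Proof. by rewrite /derivable /= translate_quotient. Qed.

(** The mean value theorem is used twice: for [fun x => f (x + h *: b) - f x] along [a], then for
    ['D_a f] along [b]. *)
Lemma second_difference (U : set V) (f : V -> R) (v a b : V) (h : R) :
  0 <= h ->
  (forall s t, 0 <= s <= h -> 0 <= t <= h -> U (v + s *: a + t *: b)) ->
  (forall x, U x -> derivable f x a) ->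
  (forall x, U x -> derivable ('D_a f) x b) ->
  exists s t, [/\ 0 <= s <= h, 0 <= t <= h &
    f (v + h *: a + h *: b) - f (v + h *: b) - (f (v + h *: a) - f v) =
      h * (h * 'D_b ('D_a f) (v + s *: a + t *: b))].
Proof.
move=> h0 Uh df ddf.
have hh : 0 <= h <= h by rewrite h0 lexx.
have z0 : 0 <= (0 : R) <= h by rewrite lexx h0.
pose k x := f (x + h *: b) - f x.
have dk s : 0 <= s <= h -> derivable (fun y => f (y + h *: b)) (v + s *: a) a.
  by move=> sh; apply/derivable_translate/df/Uh.
have dk' s : 0 <= s <= h -> derivable f (v + s *: a) a.
  by move=> sh; apply/df; have := Uh s 0 sh z0; rewrite scale0r addr0.
have [s sh E] := @mvt_line k v a h h0 (fun s sh => derivableB (dk s sh) (dk' s sh)).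
have [t th E'] := @mvt_line ('D_a f) (v + s *: a) b h h0
  (fun t th => ddf _ (Uh s t sh th)).
exists s, t; split => //.
move: E; rewrite deriveB; [|exact: dk|exact: dk'].
rewrite derive_translate E' /k => <-.
ring.
Qed.

Lemma eq_at_limit (g1 g2 : V -> R) (v : V) :
  {for v, continuous g1} -> {for v, continuous g2} ->
  (forall r : R, 0 < r ->
    exists x y, [/\ ball v r x, ball v r y & g1 x = g2 y]) ->
  g1 v = g2 v.
Proof.
move=> /cvgrPdist_lt c1 /cvgrPdist_lt c2 H.
apply/eqP; rewrite -subr_eq0 -normr_le0; apply/ler_addgt0Pl => e e0; rewrite addr0.
have e2 : 0 < e / 2 by rewrite divr_gt0.
have /nbhs_ballP[r /= r0 rP] :
    nbhs v [set x | `|g1 v - g1 x| < e / 2 /\ `|g2 v - g2 x| < e / 2].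
  exact: filterI (c1 _ e2) (c2 _ e2).
have [x [y [xr yr E]]] := H r r0.
have [B1 _] := rP _ xr; have [_ B2] := rP _ yr.
rewrite E in B1.
rewrite (le_trans (ler_distD (g2 y) _ _))//.
by rewrite [e]splitr lerD// ?ltW// distrC.
Qed.

(** The second difference over the parallelogram spanned by [h *: a] and [h *: b] is symmetric in
    [a] and [b]. It is [h * h] times either mixed derivative, each taken at some point close to [v],
    and both derivatives are continuous at [v]. *)
Lemma schwarz (U : set V) (f : V -> R) (v a b : V) : open U -> U v ->
  Ck 2 U f -> 'D_a ('D_b f) v = 'D_b ('D_a f) v.
Proof.
move=> Uo Uv [df ddf].
have d1 c x : U x -> derivable f x c by move=> /df; apply: diff_derivable.
have d2 c d x : U x -> derivable ('D_c f) x d.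
  by move=> Ux; apply: diff_derivable; apply: (ddf c).1.
have ctn c d : {for v, continuous ('D_d ('D_c f))} by exact: (ddf c).2.
apply: (eq_at_limit (ctn b a) (ctn a b)) => r r0.
have /nbhs_ballP[r1 /= r1_gt0 rU] : nbhs v U by exact: open_near.
pose r2 := Num.min r r1.
have r2_gt0 : 0 < r2 by rewrite lt_min r0.
have r2U x : ball v r2 x -> U x.
  by move=> vx; apply/rU/(le_ball _ vx); rewrite ge_min lexx orbT.
have r2r x : ball v r2 x -> ball v r x.
  by apply: le_ball; rewrite ge_min lexx.
(* The choice gives [h * N < r2], which keeps the parallelogram inside the ball of radius [r2]; the
   summand 1 keeps [N] positive when [a = b = 0]. *)
pose N := `|a| + `|b| + 1.
have N0 : 0 < N by rewrite ltr_wpDl// addr_ge0.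
pose h := r2 / N / 2.
have h0 : 0 < h by rewrite !divr_gt0.
have inr s t : 0 <= s <= h -> 0 <= t <= h -> ball v r2 (v + s *: a + t *: b).
  move=> /andP[s0 sh] /andP[t0 th].
  rewrite -ball_normE /= opprD addrA opprD addrA subrr add0r -opprD normrN.
  apply: (@le_lt_trans _ _ (h * N)).
    apply: (le_trans (ler_normD _ _)); rewrite !normrZ (ger0_norm s0) (ger0_norm t0).
    have A1 : s * `|a| <= h * `|a| by rewrite ler_wpM2r.
    have A2 : t * `|b| <= h * `|b| by rewrite ler_wpM2r.
    by apply: (le_trans (lerD A1 A2)); rewrite /N !mulrDr mulr1 lerDl ltW.
  by rewrite /h mulrAC divfK ?gt_eqF// ltr_pdivrMr// ltr_pMr// ltr1n.
have inr' s t : 0 <= s <= h -> 0 <= t <= h -> ball v r2 (v + s *: b + t *: a).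
  by move=> sh th; rewrite addrAC; apply: inr.
have [s [t [sh th E]]] := second_difference (ltW h0)
  (fun s t sh th => r2U _ (inr s t sh th)) (d1 a) (d2 a b).
have [s' [t' [sh' th' E']]] := second_difference (ltW h0)
  (fun s t sh th => r2U _ (inr' s t sh th)) (d1 b) (d2 b a).
exists (v + s' *: b + t' *: a), (v + s *: a + t *: b).
split; [exact/r2r/inr'|exact/r2r/inr|].
apply: (mulfI (lt0r_neq0 h0)); apply: (mulfI (lt0r_neq0 h0)).
have swap (p q s0 t0 : R) : p - q - (s0 - t0) = p - s0 - (q - t0) by ring.
apply: (etrans (esym E')); apply: etrans E.
by rewrite (addrAC v (h *: b)) swap.
Qed.

End Schwarz.

(** * Algebraic rules for directional derivatives *)

Section DeriveRules.
Context {R : realType} {V : normedModType R}.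
Implicit Types (f g : V -> R) (x v a b : V).

Lemma is_derive_mul f g x v (df dg : R) :
  is_derive x v f df -> is_derive x v g dg ->
  is_derive x v (fun y => f y * g y) (f x * dg + g x * df).
Proof. by move=> ? ?; exact: is_deriveM. Qed.

Lemma is_derive_add f g x v (df dg : R) :
  is_derive x v f df -> is_derive x v g dg ->
  is_derive x v (fun y => f y + g y) (df + dg).
Proof. by move=> ? ?; exact: is_deriveD. Qed.

Lemma is_derive_opp f x v (df : R) :
  is_derive x v f df -> is_derive x v (fun y => - f y) (- df).
Proof. by move=> ?; exact: is_deriveN. Qed.

Lemma is_derive_sub f g x v (df dg : R) :
  is_derive x v f df -> is_derive x v g dg ->
  is_derive x v (fun y => f y - g y) (df - dg).
Proof. by move=> ? ?; exact: is_deriveB. Qed.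

Lemma is_derive_inv f x v (df : R) : f x != 0 ->
  is_derive x v f df ->
  is_derive x v (fun y => (f y)^-1) (- ((f x)^-1 * (f x)^-1) * df).
Proof.
move=> fx [df0 df1]; split; first exact: derivableV.
by rewrite deriveV// df1 -exprVn.
Qed.

Lemma is_derive_half_sqr f x v (df : R) : is_derive x v f df ->
  is_derive x v (fun y => f y ^+ 2 / 2) (f x * df).
Proof.
move=> fd; have fd2 := is_derive_mul (is_derive_mul fd fd) (is_derive_cst (2^-1 : R) x v).
by apply: is_derive_eq fd2 _; rewrite /cst; lra.
Qed.

End DeriveRules.

(** * Homogeneous functions on one tangent space and the Hessian of the Matsumoto energy *)

Section FibreCalculus.
Context {R : realType} {V : normedModType R}.
Implicit Types (f g : V -> R) (x v a b : V).

Lemma Ck_derivable k (U : set V) f x a : Ck k.+1 U f -> U x -> derivable f x a.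
Proof. by move=> [df _] Ux; apply: diff_derivable; exact: df. Qed.

Lemma Ck_is_derive k (U : set V) f x a : Ck k.+1 U f -> U x ->
  is_derive x a f ('D_a f x).
Proof. by move=> fk Ux; apply: derivableP; exact: Ck_derivable fk Ux. Qed.

Lemma CkD k (U : set V) f a : Ck k.+1 U f -> Ck k U ('D_a f).
Proof. by case=> _; apply. Qed.

Lemma CkW k (U : set V) f : Ck k.+1 U f -> Ck k U f.
Proof.
elim: k f => [|k IH] f [df ddf]; first by move=> x /df /differentiable_continuous.
by split=> // a; apply: IH.
Qed.

(** A direct computation by the product rule, with the quotient written as [f * f * q]. The value 0
    for the derivative of [Qb] says that [Q] contributes no second-order term. *)
Lemma hessian_matsumoto f Q v a b (fb Qb : V -> R) (fa Qa fab : R) :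
  {for v, continuous f} -> {for v, continuous Q} ->
  (\forall x \near v, is_derive x b f (fb x)) ->
  (\forall x \near v, is_derive x b Q (Qb x)) ->
  is_derive v a f fa -> is_derive v a Q Qa ->
  is_derive v a fb fab -> is_derive v a Qb 0 ->
  f v - Q v != 0 ->
  'D_a ('D_b (fun x => (f x ^+ 2 / (f x - Q x)) ^+ 2 / 2)) v =
      f v ^+ 2 * (f v - 2 * Q v) / (f v - Q v) ^+ 3 * (f v * fab + fb v * fa)
      + 3 * f v ^+ 4 / (f v - Q v) ^+ 4 * (Qa * Qb v)
      + f v ^+ 2 * Q v * (4 * Q v - f v) / (f v - Q v) ^+ 4 * (fa * fb v)
      + f v ^+ 3 * (f v - 4 * Q v) / (f v - Q v) ^+ 4 * (Qa * fb v + Qb v * fa).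
Proof.
move=> fc Qc nfb nQb fda Qda fbda Qbda v0.
pose q x := (f x - Q x)^-1.
have qd x c fx Qx : f x - Q x != 0 -> is_derive x c f fx -> is_derive x c Q Qx ->
    is_derive x c q (- (q x * q x) * (fx - Qx)).
  move=> x0 fd Qd.
  exact: (@is_derive_inv _ _ (fun y => f y - Q y) x c _ x0 (is_derive_sub fd Qd)).
have ne0 : \forall x \near v, f x - Q x != 0.
  have : (fun x => f x - Q x) @ v --> f v - Q v by exact: cvgB.
  by move=> /(_ _ (open_near (@open_neq R 0) v0)).
(* The first derivative of the energy in direction [b]: the function [f * f * q] times its own
   derivative. *)
pose H' (x : V) : R := (f x * f x * q x) *
   ((f x * f x) * (- (q x * q x) * (fb x - Qb x))
   + q x * (f x * fb x + f x * fb x)).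
(* The formula for ['D_b] is available only near [v], where [f - Q] does not vanish; this suffices,
   since ['D_a] at [v] sees only the germ. *)
have -> : 'D_a ('D_b (fun x => (f x ^+ 2 / (f x - Q x)) ^+ 2 / 2)) v = 'D_a H' v.
  apply: near_eq_derive; near=> x.
  have x0 : f x - Q x != 0 by near: x.
  have fd : is_derive x b f (fb x) by near: x.
  have Qd : is_derive x b Q (Qb x) by near: x.
  have [_ E] := is_derive_half_sqr
    (is_derive_mul (is_derive_mul fd fd) (qd x b _ _ x0 fd Qd)).
  exact: E.
have qa := qd v a _ _ v0 fda Qda.
have qq := is_derive_mul (is_derive_opp (is_derive_mul qa qa))
  (is_derive_sub fbda Qbda).
have ff := is_derive_mul fda fda.
have [_ ->] := is_derive_mul (is_derive_mul ff qa)
  (is_derive_add (is_derive_mul ff qq)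
     (is_derive_mul qa
       (is_derive_add (is_derive_mul fda fbda) (is_derive_mul fda fbda)))).
rewrite /q.
move: (fb v) (Qb v) (f v) (Q v) v0 => fb' Qb' F Q' v0.
by field.
Unshelve. all: by end_near. Qed.

Section Homogeneous.
Variables (U : set V) (f : V -> R).
Hypotheses (Uo : open U) (fC : Ck 3 U f).
Hypothesis f_hom : forall (t : R) x, 0 < t -> U x -> f (t *: x) = t * f x.

(** Along the ray, [f (x + s *: x)] is [(1 + s) * f x], which is affine in [s] with slope [f x]. *)
Lemma euler x : U x -> 'D_x f x = f x.
Proof.
move=> Ux.
have := derive_line f x x 0; rewrite scale0r addr0 => <-.
have sd : is_derive (0 : R) (1 : R) (fun s : R => f x + s * f x) (f x).
  have h := is_derive_add (is_derive_cst (f x) (0 : R) 1)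
    (is_derive_mul (is_derive_id (0 : R) (1 : R)) (is_derive_cst (f x) (0 : R) 1)).
  by apply: is_derive_eq h _; rewrite /cst /=; ring.
rewrite -[RHS](@derive_val _ _ _ _ _ _ _ sd); apply: near_eq_derive.
(* Homogeneity applies to the factor [1 + s] once [s > -1], hence for [s] near 0. *)
near=> s; rewrite -[X in X + s *: x]scale1r -scalerDl f_hom ?mulrDl ?mul1r//.
rewrite -ltrBlDl sub0r; near: s.
by apply: lt_nbhsr; rewrite oppr_lt0.
Unshelve. all: by end_near. Qed.

(* At x + s a, the derivative of f in the frozen direction x is f - s D_a f, by
   Euler's identity at x + s a. *)
Lemma derive_radial x a : U x -> 'D_a ('D_x f) x = 0.
Proof.
move=> Ux.
have fC2 := CkW fC.
have := derive_line ('D_x f) x a 0; rewrite scale0r addr0 => <-.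
have ld (g : V -> R) : Ck 2 U g ->
    is_derive (0 : R) (1 : R) (fun s : R => g (x + s *: a)) ('D_a g x).
  move=> gC; have := derive_line g x a 0; rewrite scale0r addr0 => <-.
  apply: derivableP; apply: derivable_line; rewrite scale0r addr0.
  exact: Ck_derivable gC Ux.
have sd := is_derive_sub (ld f fC2)
  (is_derive_mul (is_derive_id (0 : R) (1 : R)) (ld _ (CkD a fC))).
rewrite -[RHS](_ : 'D_a f x - (0 * 'D_a ('D_a f) x + 'D_a f (x + 0 *: a) * 1) = 0);
  last by rewrite scale0r addr0; ring.
rewrite -[RHS](@derive_val _ _ _ _ _ _ _ sd); apply: near_eq_derive.
near=> s.
have Us : U (x + s *: a).
  near: s; have : (fun s : R => x + s *: a) @ (0 : R) --> x + 0 *: a.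
    by apply: cvgD; [exact: cvg_cst|apply: cvgZr_tmp; exact: cvg_id].
  by rewrite scale0r addr0 => /(_ _ (open_near Uo Ux)).
have fd := (fC2.1 _ Us).
rewrite -[in RHS](euler Us) !deriveE//.
by rewrite linearD linearZ /= addrK.
Unshelve. all: by end_near. Qed.

Lemma radial_derive x a : U x -> 'D_x ('D_a f) x = 0.
Proof. by move=> Ux; rewrite (schwarz x a Uo Ux (CkW fC)) derive_radial. Qed.

(* e is kept abstract: the conversion of iterated derivatives of an explicit
   function is intractable. *)
Variable e : V -> R.
Hypothesis eE : forall x, e x = f x ^+ 2 / 2.

Lemma derive_energy x a : U x -> 'D_a e x = f x * 'D_a f x.
Proof.
move=> Ux; rewrite (funext eE).
by have [] := is_derive_half_sqr (Ck_is_derive a fC Ux).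
Qed.

Lemma derive2_energy x a b : U x ->
  is_derive x a ('D_b e) (f x * 'D_a ('D_b f) x + 'D_b f x * 'D_a f x).
Proof.
move=> Ux.
have h := is_derive_mul (Ck_is_derive a fC Ux) (Ck_is_derive a (CkD b fC) Ux).
apply: near_eq_is_derive h.
by near=> y; rewrite derive_energy//; near: y; exact: open_near.
Unshelve. all: by end_near. Qed.

Lemma energy_symm x a b : U x -> 'D_a ('D_b e) x = 'D_b ('D_a e) x.
Proof.
move=> Ux; have [_ ->] := derive2_energy a b Ux; have [_ ->] := derive2_energy b a Ux.
by rewrite (schwarz a b Uo Ux (CkW fC)) [X in _ + X]mulrC.
Qed.

(** In the Hessian [f * f_xa + f_x * f_a] the first term vanishes by homogeneity and [f_x = f] by
    Euler. Where [f] is nonzero, this identifies the supporting form with the differential of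
    [f]. *)
Lemma energy_radial x a : U x -> 'D_x ('D_a e) x = f x * 'D_a f x.
Proof.
move=> Ux; have [_ ->] := derive2_energy x a Ux.
by rewrite radial_derive// euler// mulr0 add0r mulrC.
Qed.

Variables (v p : V) (P : V -> R).
Hypothesis Uv : U v.
Hypothesis PE : \forall x \near v, P x = 'D_p ('D_x e) x.
Hypothesis cartan0 : forall a b, 'D_a ('D_p ('D_b e)) v = 0.
Hypothesis P_lt : P v < f v.

(** Here [p] is the value of the concurrent field and [P] is Phi on the fibre. By symmetry and
    Euler, [P] agrees near [v] with [Q = 'D_p e]. The derivative of [Q] in direction [c] is g(p, c),
    whose derivatives at [v] vanish by [cartan0], so [hessian_matsumoto] applies to [Q]. *)
Lemma metric_matsumoto a b (gab gpa gpb gva gvb : R) :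
  'D_a ('D_b e) v = gab ->
  'D_p ('D_a e) v = gpa -> 'D_p ('D_b e) v = gpb ->
  'D_v ('D_a e) v = gva -> 'D_v ('D_b e) v = gvb ->
  'D_a ('D_b (fun x => (f x ^+ 2 / (f x - P x)) ^+ 2 / 2)) v =
      f v ^+ 2 * (f v - 2 * P v) / (f v - P v) ^+ 3 * gab
      + 3 * f v ^+ 4 / (f v - P v) ^+ 4 * (gpa * gpb)
      + f v ^+ 2 * P v * (4 * P v - f v) / (f v - P v) ^+ 4
        * (((f v)^-1 * gva) * ((f v)^-1 * gvb))
      + f v ^+ 3 * (f v - 4 * P v) / (f v - P v) ^+ 4
        * (gpa * ((f v)^-1 * gvb) + gpb * ((f v)^-1 * gva)).
Proof.
move=> Eab Epa Epb Eva Evb.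
(* The existential makes [Q] opaque, so that conversion never unfolds the iterated derivative. *)
have [Q /esym Qe] : exists Q, Q = 'D_p e by exists ('D_p e).
have PQ : \forall x \near v, P x = Q x.
  near=> x; have Ux : U x by near: x; exact: open_near.
  by rewrite (near PE x)// energy_symm// energy_radial// -Qe derive_energy.
have Qd x c : U x -> is_derive x c Q ('D_c Q x).
  by move=> Ux; have [h _] := derive2_energy c p Ux; rewrite -Qe; exact: derivableP.
have QE c x : U x -> 'D_c Q x = 'D_p ('D_c e) x.
  by move=> Ux; rewrite -Qe energy_symm.
(* Derivability comes from the explicit formula for ['D_c Q] in terms of [f], which involves third
   derivatives of [f]; the value 0 comes from [cartan0]. *)
have ddQ c d : is_derive v d ('D_c Q) 0.
  have h := is_derive_add
      (is_derive_mul (Ck_is_derive d fC Uv) (Ck_is_derive d (CkD c (CkD p fC)) Uv))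
      (is_derive_mul (Ck_is_derive d (CkD p fC) Uv) (Ck_is_derive d (CkD c fC) Uv)).
  have nQ : \forall x \near v, f x * 'D_c ('D_p f) x + 'D_p f x * 'D_c f x = 'D_c Q x.
    near=> x; have Ux : U x by near: x; exact: open_near.
    by rewrite -Qe; have [_ E] := derive2_energy c p Ux; exact: esym E.
  have [h1 _] := near_eq_is_derive nQ h.
  split => //; rewrite -(cartan0 d c); apply: near_eq_derive.
  by near=> x; apply: QE; near: x; exact: open_near.
have Pv : P v = Q v by exact: nbhs_singleton PQ.
have {}Eab : gab = f v * 'D_a ('D_b f) v + 'D_b f v * 'D_a f v.
  by have [_ E] := derive2_energy a b Uv; exact: etrans (esym Eab) E.
have {}Epa : gpa = 'D_a Q v by exact: etrans (esym Epa) (esym (QE a v Uv)).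
have {}Epb : gpb = 'D_b Q v by exact: etrans (esym Epb) (esym (QE b v Uv)).
have {}Eva : gva = f v * 'D_a f v by exact: etrans (esym Eva) (energy_radial a Uv).
have {}Evb : gvb = f v * 'D_b f v by exact: etrans (esym Evb) (energy_radial b Uv).
subst gab gpa gpb gva gvb.
(* The inner derivative at a nearby [x] needs [P = Q] on a neighbourhood of [x], not only at [x];
   hence [near_join]. *)
have -> : 'D_a ('D_b (fun x => (f x ^+ 2 / (f x - P x)) ^+ 2 / 2)) v =
    'D_a ('D_b (fun x => (f x ^+ 2 / (f x - Q x)) ^+ 2 / 2)) v.
  apply: near_eq_derive; near=> x; apply: near_eq_derive.
  have PQx : \forall y \near x, P y = Q y by near: x; exact: near_join.
  by near=> y; rewrite (near PQx y).
have fa := Ck_is_derive a fC Uv.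
have Qa := Qd v a Uv.
have faa := Ck_is_derive a (CkD b fC) Uv.
have fc : {for v, continuous f} by apply: differentiable_continuous; exact: fC.1.
have Qc : {for v, continuous Q}.
  have nQ : \forall x \near v, f x * 'D_p f x = Q x.
    near=> x; have Ux : U x by near: x; exact: open_near.
    by rewrite -Qe; exact: esym (derive_energy p Ux).
  have c : (fun x => f x * 'D_p f x) @ v --> f v * 'D_p f v.
    have fpc : {for v, continuous ('D_p f)}.
      by apply: differentiable_continuous; exact: (CkD p fC).1.
    exact: cvgM fc fpc.
  rewrite /prop_for /continuous_at -(nbhs_singleton nQ).
  by apply: cvg_trans c; exact: near_eq_cvg.
have nf : \forall x \near v, is_derive x b f ('D_b f x).
  by near=> x; apply: Ck_is_derive fC _; near: x; exact: open_near.
have nQ : \forall x \near v, is_derive x b Q ('D_b Q x).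
  by near=> x; apply: Qd; near: x; exact: open_near.
have v0 : f v - Q v != 0 by rewrite -Pv subr_eq0 gt_eqF.
apply: etrans (hessian_matsumoto fc Qc nf nQ fa Qa faa (ddQ b a) v0) _.
rewrite Pv.
move: v0; move: (f v) (Q v) ('D_a ('D_b f) v) ('D_a f v) ('D_b f v) ('D_a Q v) ('D_b Q v).
move=> F q0 fab fva fvb Qva Qvb v0.
(* When [f v = 0] the factor [(f v)^-1] cannot be cancelled, but every coefficient carries a
   positive power of [f v], so both sides are 0. *)
have [->|F0] := eqVneq F 0; last by rewrite !(mulKf F0); ring.
by rewrite !expr0n /= !mul0r ?mulr0 !mul0r.
Unshelve. all: by end_near. Qed.

End Homogeneous.
End FibreCalculus.

(** * Derivatives of maps into products, and smooth maps *)

Section Products.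
Context {R : realType} {V W1 W2 : normedModType R}.

Lemma is_derive_cvg (W : normedModType R) (f : V -> W) (p v : V) (l : W) :
  (fun h : R => h^-1 *: (f (h *: v + p) - f p)) @ 0^' --> l ->
  is_derive p v f l.
Proof. by move=> fl; split; [apply/cvg_ex; exists l|exact: cvg_lim fl]. Qed.

Lemma derive_cvg (W : normedModType R) (f : V -> W) (p v : V) :
  derivable f p v ->
  (fun h : R => h^-1 *: (f (h *: v + p) - f p)) @ 0^' --> 'D_v f p.
Proof. by []. Qed.

Lemma is_derive_fst (f : V -> (W1 * W2)%type) (p v : V) : derivable f p v ->
  is_derive p v (fun q => (f q).1) ('D_v f p).1.
Proof.
move=> /derive_cvg fl; apply: is_derive_cvg.
exact: (cvg_comp _ (@fst W1 W2) fl (@cvg_fst _ _ _ _ _)).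
Qed.

Lemma is_derive_snd (f : V -> (W1 * W2)%type) (p v : V) : derivable f p v ->
  is_derive p v (fun q => (f q).2) ('D_v f p).2.
Proof.
move=> /derive_cvg fl; apply: is_derive_cvg.
exact: (cvg_comp _ (@snd W1 W2) fl (@cvg_snd _ _ _ _ _)).
Qed.

Lemma is_derive_pair (f : V -> W1) (g : V -> W2) (p v : V) df dg :
  is_derive p v f df -> is_derive p v g dg ->
  is_derive p v (fun q => (f q, g q)) (df, dg).
Proof.
move=> [/derive_cvg fl <-] [/derive_cvg gl <-]; apply: is_derive_cvg.
exact: (cvg_pair fl gl).
Qed.

End Products.

Section Smooth.
Context {R : realType}.

Lemma smooth_on_cst (V1 V2 : normedModType R) (U : set V1) (c : V2) :
  smooth_on U (cst c).
Proof.
move=> k; elim: k c => [|k IH] c /=; first by move=> p _; exact: cst_continuous.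
split=> [p _|v]; first exact: differentiable_cst.
suff -> : (fun p : V1 => 'D_v (cst c : V1 -> V2) p) = cst 0 by exact: IH.
by apply/funext => p; exact: derive_cst.
Qed.

Lemma smooth_differentiable (V1 V2 : normedModType R) (U : set V1) (f : V1 -> V2) p :
  smooth_on U f -> U p -> differentiable f p.
Proof. by move=> /(_ 1%N)[df _]; exact: df. Qed.

Lemma smooth_derivable (V1 V2 : normedModType R) (U : set V1) (f : V1 -> V2) p v :
  smooth_on U f -> U p -> derivable f p v.
Proof. by move=> fS Up; apply/diff_derivable/smooth_differentiable; first exact: fS. Qed.

Lemma smooth_derive (V1 V2 : normedModType R) (U : set V1) (f : V1 -> V2) v :
  smooth_on U f -> smooth_on U ('D_v f).
Proof. by move=> fS k; have [_] := fS k.+1; apply. Qed.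

End Smooth.
Arguments smooth_derivable {R V1 V2 U f p} v _ _.

(** * The Barthel, Berwald and Cartan connections in a natural chart *)

Section NaturalChart.
Context {R : realType} {n : nat}.
Local Notation X := 'rV[R]_n.
Local Notation V := (X * X)%type.
Implicit Types (x w : X) (p q : V).

Definition vert (w : X) : V := (0, w).

(* For a spray G, - vert_derive G p w / 2 is N^i_j w^j, with N^i_j the
   coefficients of the Barthel connection. *)
Definition vert_derive (G : V -> V) (p : V) (w : X) : X := ('D_(vert w) G p).2.

(** Since [dJ E] kills vertical vectors, one of the two terms of the exterior derivative drops out
    and the vertical Hessian remains. *)
Lemma metricE (E : V -> R) p a b :
  metric E p a b = 'D_(vert a) (fun q => 'D_(vert b) E q) p.
Proof.
have E0 : (fun q => dJ E q (vert a)) = cst 0.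
  by apply/funext => q; exact: derive0.
apply: (etrans _ (subr0 _)); congr (_ - _).
exact: etrans (congr1 (fun g : V -> R => 'D_((b, 0) : V) g p) E0)
  (derive_cst 0 p ((b, 0) : V)).
Qed.
Lemma metric0l (E : V -> R) p b : metric E p 0 b = 0.
Proof. by rewrite metricE derive0. Qed.

Lemma metric0r (E : V -> R) p a : metric E p a 0 = 0.
Proof.
rewrite metricE (_ : (fun q => 'D_(vert 0) E q) = cst 0) ?derive_cst//.
by apply/funext => q; exact: derive0.
Qed.

Section Spray.
Variables (U : set V) (G : V -> V).
Hypotheses (Uo : open U) (GS : smooth_on U G).
Hypothesis G1 : forall p, U p -> (G p).1 = p.2.

Lemma derive_spray_fst p (w : V) : U p -> ('D_w G p).1 = w.2.
Proof.
move=> Up; have [_ <-] := is_derive_fst (smooth_derivable w GS Up).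
have di : derivable (id : V -> V) p w by exact: derivable_id.
have [_ E] := is_derive_snd di.
rewrite derive_id in E; rewrite -E; apply: near_eq_derive.
by near=> q; apply: G1; near: q; exact: (open_near Uo Up).
Unshelve. all: by end_near. Qed.

(** On expanding the brackets, the derivative of [Z] along [G] cancels, and so does the vertical
    part of [Z], because [('D_(Z p) G p).1] equals [(Z p).2]. Thus the result at [p] depends on
    [(Z p).1] alone. *)
Lemma hprojE (Z : V -> V) p : smooth_on U Z -> U p ->
  hproj G Z p = ((Z p).1, 2^-1 *: vert_derive G p (Z p).1).
Proof.
move=> ZS Up.
have dJZ (w : V) : 'D_w (vertJ Z) p = (0, ('D_w Z p).1).
  have [_ E] := is_derive_pair (is_derive_cst (0 : X) p w)
    (is_derive_fst (smooth_derivable w ZS Up)).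
  exact: E.
have cancel (a b c : X) : a + (b - c - (a - c)) = b.
  by rewrite opprB -!addrA addKr addrCA subrr addr0.
have EZ := derive_spray_fst (Z p) Up.
have EJ := derive_spray_fst (vert ((Z p).1)) Up.
rewrite /vert_derive /hproj /barthel /lie_bracket dJZ /vertJ /gam /rho.
move: EZ EJ; move: ('D_(Z p) G p) ('D_(vert ((Z p).1)) G p) ('D_(G p) Z p).
move=> D1 D2 D3 /= EZ EJ.
rewrite [LHS]surjective_pairing /= EZ EJ !subr0; congr (_, _ *: _).
  rewrite -[X in X + X]scale1r -scalerDl scalerA.
  by rewrite mulVf ?pnatr_eq0// scale1r.
exact: cancel.
Qed.

Lemma betaE (W : V -> X) p : U p ->
  beta U G W p = (W p, 2^-1 *: vert_derive G p (W p)).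
Proof.
move=> Up; apply: xget_unique => /=.
  (* A constant field serves as witness: it is smooth whatever [W] is, and only its first component
     at [p] matters. *)
  split=> //; exists (cst (W p, 0)); first exact: smooth_on_cst.
  by rewrite hprojE//; exact: smooth_on_cst.
move=> b [b1 [Z ZS E]].
have Eb := etrans E (hprojE ZS Up).
have Z1 : (Z p).1 = W p by rewrite -b1 Eb.
by move: Z1 Eb; move: (Z p).1 => z -> ->.
Qed.

Lemma derivable_vertical_derive (W : V -> X) p (v : V) : U p ->
  derivable W p v ->
  derivable (fun q => vert_derive G q (W q)) p v.
Proof.
move=> Up Wd; apply/derivable_mxP => i j.
(* The direction [W q] moves with [q]. Expanding it in the standard basis leaves derivatives of [G]
   in fixed directions, to which the product rule applies. *)
apply: (@near_eq_derivable _ _ _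
  (\sum_(k < n) (fun q => W q 0 k * (vert_derive G q (delta_mx 0 k)) i j))).
  near=> q.
  have Uq : U q by near: q; exact: (open_near Uo Up).
  have Gd := smooth_differentiable GS Uq.
  rewrite fct_sumE.
  pose L w := vert_derive G q w i j.
  have LD : {morph L : w1 w2 / w1 + w2}.
    move=> w1 w2; rewrite /L /vert_derive !deriveE//.
    have -> : vert (w1 + w2) = vert w1 + vert w2
      by rewrite /vert; congr (_, _); rewrite addr0.
    by rewrite linearD /= mxE.
  have LZ c w : L (c *: w) = c * L w.
    rewrite /L /vert_derive !deriveE//.
    have -> : vert (c *: w) = c *: vert w
      by rewrite /vert; congr (_, _); rewrite scaler0.
    by rewrite linearZ /= mxE.
  have L0 : L 0 = 0 by rewrite -(scale0r 0) LZ mul0r.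
  apply: (etrans _ (congr1 L (esym (row_sum_delta (W q))))).
  apply: (etrans _ (esym (big_morph L LD L0 _ _ _))).
  by apply: eq_bigr => k _; apply/esym/LZ.
apply: derivable_sum => k; apply: derivableM.
  by move/derivable_mxP : Wd; exact.
have h : derivable (fun q => vert_derive G q (delta_mx 0 k)) p v.
  by apply: (@ex_derive _ _ _ _ _ _ _ (is_derive_snd
       (smooth_derivable v (smooth_derive _ GS) Up))).
by move/derivable_mxP : h; exact.
Unshelve. all: by end_near. Qed.

(** The second component must be shown derivable too, since the derivative of a pair is a limit of
    pairs. *)
Lemma derive_beta_fst (W : V -> X) p (v : V) : U p -> derivable W p v ->
  ('D_v (beta U G W) p).1 = 'D_v W p.
Proof.
move=> Up Wd.
have nb : \forall q \near p, (W q, 2^-1 *: vert_derive G q (W q)) = beta U G W q.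
  by near=> q; rewrite betaE//; near: q; exact: (open_near Uo Up).
have d2 : derivable (fun q => 2^-1 *: vert_derive G q (W q)) p v.
  by apply: derivableZ; exact: derivable_vertical_derive.
have [_ ->] := near_eq_is_derive nb (is_derive_pair (derivableP Wd) (derivableP d2)).
by [].
Unshelve. all: by end_near. Qed.

Lemma bracket_vertical_beta (W : V -> X) p w : U p ->
  derivable W p (vert w) ->
  rho (lie_bracket (gam (cst w)) (beta U G W)) p = 'D_(vert w) W p.
Proof.
move=> Up Wd.
have gE : gam (cst w) = cst (vert w) by [].
have E : 'D_(beta U G W p) (cst (vert w)) p = 0 by exact: derive_cst.
by rewrite /rho /lie_bracket gE E subr0; exact: derive_beta_fst.
Qed.

Lemma bracket_beta_vertical (W : V -> X) p w : U p ->
  derivable W p (vert w) ->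
  rho (lie_bracket (beta U G W) (gam (cst w))) p = - 'D_(vert w) W p.
Proof.
move=> Up Wd.
have gE : gam (cst w) = cst (vert w) by [].
have E : 'D_(beta U G W p) (cst (vert w)) p = 0 by exact: derive_cst.
rewrite /rho /lie_bracket gE E sub0r.
by rewrite -(derive_beta_fst Up Wd).
Qed.

Section Concurrent.
Variables (E : V -> R) (nab : (V -> V) -> (V -> X) -> V -> X) (phi : V -> X).
Hypotheses (cartan : is_cartan U E G nab) (phiS : smooth_on U phi).
Hypothesis conc : concurrent_on U G nab phi.

Lemma concurrent_vertical p w : U p -> 'D_(vert w) phi p = 0.
Proof.
move=> Up; have [_ _ _] := conc (smooth_on_cst U (w : X)) Up.
exact: etrans (esym (bracket_vertical_beta Up (smooth_derivable (vert w) phiS Up))).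
Qed.

(** The vertical Koszul formula is tested on constant fields. Its left side vanishes by concurrence,
    one bracket vanishes because [z] is constant and the other because [phi] does not vary
    vertically; only the derivative of the metric term remains. *)
Lemma concurrent_cartan p w z : U p ->
  'D_(vert w) (fun q => metric E q (phi q) z) p = 0.
Proof.
move=> Up; have wS := smooth_on_cst U (w : X); have zS := smooth_on_cst U (z : X).
have [H _] := cartan wS phiS zS Up.
have [_ _ N _] := conc wS Up.
have E1 := bracket_beta_vertical Up (smooth_derivable (vert w) zS Up).
have E2 := bracket_vertical_beta Up (smooth_derivable (vert w) phiS Up).
rewrite derive_cst oppr0 in E1.
rewrite (concurrent_vertical w Up) in E2.
have M0 : metric E p (nab (gam (cst w)) phi p) z = 0.
  by rewrite N; exact: metric0l.
have M1 : metric E p (phi p)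
    (rho (lie_bracket (beta U G (cst z)) (gam (cst w))) p) = 0.
  by rewrite E1; exact: metric0r.
have M2 : metric E p z
    (rho (lie_bracket (gam (cst w)) (beta U G phi)) p) = 0.
  by rewrite E2; exact: metric0r.
have drop (r s t1 t2 : R) : 2 * r = s + t1 + t2 -> r = 0 -> t1 = 0 -> t2 = 0 -> s = 0.
  by move=> rE r0 t10 t20; move: rE; rewrite r0 t10 t20 mulr0 !addr0.
exact: drop H M0 M1 M2.
Qed.

End Concurrent.
End Spray.
End NaturalChart.

(** * Restriction of chart functions to a fibre *)

Section Fibre.
Context {R : realType} {n : nat}.
Local Notation X := 'rV[R]_n.
Local Notation V := (X * X)%type.

Lemma slice_quotient (W : normedModType R) (f : V -> W) (x v a : X) :
  (fun h : R => h^-1 *: (f (h *: (vert a) + (x, v)) - f (x, v)))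
  = (fun h : R => h^-1 *: (f (x, h *: a + v) - f (x, v))).
Proof.
apply/funext => h; congr (_ *: (f _ - _)).
by congr (_, _); rewrite /= scaler0 add0r.
Qed.

Lemma derive_slice (W : normedModType R) (f : V -> W) (x v a : X) :
  'D_a (fun w => f (x, w)) v = 'D_(vert a) f (x, v).
Proof. by rewrite /derive /= slice_quotient. Qed.

Lemma metric_slice (E : V -> R) (x w a b : X) :
  metric E (x, w) a b = 'D_a ('D_b (fun w' => E (x, w'))) w.
Proof.
rewrite metricE -derive_slice.
apply: (congr1 (fun h : X -> R => 'D_a h w)).
by apply/funext => w'; exact: esym (derive_slice _ _ _ _).
Qed.

Lemma differentiable_slice (W : normedModType R) (f : V -> W) (x v : X) :
  differentiable f (x, v) -> differentiable (fun w => f (x, w)) v.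
Proof.
by move=> fd; apply: (@differentiable_comp _ _ _ _ (fun w : X => (x, w) : V) f).
Qed.

Lemma pair_continuous (x : X) : continuous (fun w : X => (x, w) : V).
Proof. by move=> w; apply: differentiable_continuous. Qed.

Lemma open_slice (U : set V) (x : X) : open U -> open [set w | U (x, w)].
Proof.
move=> Uo; apply: (@open_comp _ _ (fun w : X => (x, w) : V)) => // w _.
exact: pair_continuous.
Qed.

Lemma Ck_slice (W : normedModType R) (U : set V) (x : X) k (f : V -> W) :
  Ck k U f -> Ck k [set w | U (x, w)] (fun w => f (x, w)).
Proof.
elim: k f => [|k IH] f /=.
  move=> fc w /fc; apply: (@continuous_comp _ _ _ (fun w : X => (x, w) : V) f).
  exact: pair_continuous.
move=> [df ddf]; split=> [w /df|a]; first exact: differentiable_slice.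
suff -> : (fun w => 'D_a (fun w => f (x, w)) w) = (fun w => 'D_(vert a) f (x, w)).
  exact: IH (ddf (vert a)).
by apply/funext => w; exact: derive_slice.
Qed.

Lemma open_neq0 (W : normedModType R) : open [set w : W | w != 0].
Proof.
rewrite (_ : [set w | _] = (fun w : W => `|w|) @^-1` [set y | y != 0]).
  by apply: open_comp => [w _|]; [exact: norm_continuous|exact: open_neq].
by apply/seteqP; split => w /=; rewrite normr_eq0.
Qed.

Lemma derive_comp_eq0 (V1 V2 V3 : normedModType R) (f : V1 -> V2) (g : V2 -> V3)
    (p v : V1) : differentiable f p -> differentiable g (f p) ->
  'D_v f p = 0 -> 'D_v (g \o f) p = 0.
Proof.
move=> fd gd; rewrite (deriveE v fd) (deriveE v (differentiable_comp fd gd)).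
by move=> fv; rewrite (diff_comp fd gd) /= fv linear0.
Qed.

(** On a ball inside [U], each component obeys the mean value theorem along the segment from [v] to
    [w]. *)
Lemma locally_constant (f : X -> X) (U : set X) (v : X) : open U -> U v ->
  (forall w, U w -> differentiable f w) ->
  (forall w a, U w -> 'D_a f w = 0) ->
  \forall w \near v, f w = f v.
Proof.
move=> Uo Uv df f0.
have /nbhs_ballP[r /= r0 rU] : nbhs v U by exact: (open_near Uo Uv).
have : nbhs v (ball v r) by exact: nbhsx_ballx.
apply: filterS => w vw.
apply/rowP => i; apply/eqP; rewrite -subr_eq0; apply/eqP.
have seg s : 0 <= s <= 1 -> U (v + s *: (w - v)).
  move=> /andP[s0 s1]; apply: rU; move: vw; rewrite -!ball_normE /=.
  rewrite opprD addrA subrr add0r normrN normrZ (ger0_norm s0) distrC => vw.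
  by rewrite (le_lt_trans _ vw)// ler_piMl.
pose g (y : X) : R := f y 0 i.
have gd y : U y -> derivable f y (w - v) by move=> Uy; apply/diff_derivable/df.
have gd' y : U y -> derivable g y (w - v).
  by move=> /gd/derivable_mxP; exact.
have [s sh E] := mvt_line ler01 (fun s sh => gd' _ (seg s sh)).
move: E; rewrite scale1r mul1r (addrC v) subrK /g => ->.
have := f0 _ (w - v) (seg s sh); rewrite derive_mx; last exact/gd/seg.
by move=> /rowP/(_ i); rewrite !mxE.
Qed.

End Fibre.

(** * Natural charts of the tangent bundle *)

Section Charts.
Context {R : realType} {n : nat} {M : manifold R n}.
Local Notation X := 'rV[R]_n.
Local Notation V := (X * X)%type.
Implicit Types (c d : chart M) (x : M) (q v w : X).

Lemma cmapKinv c q : (cmap c @` dom c) q -> cmap c (cinv c q) = q.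
Proof. by move=> [y yc <-]; rewrite cmapK. Qed.

Lemma dom_cinv c q : (cmap c @` dom c) q -> dom c (cinv c q).
Proof. by move=> [y yc <-]; rewrite cmapK. Qed.

Lemma near_codom c q : (cmap c @` dom c) q ->
  \forall q' \near q, (cmap c @` dom c) q'.
Proof. by move=> cq; exact: (open_nbhs_nbhs (conj (@codom_open _ _ M c) cq)). Qed.

Lemma derive_transition_id c q v : (cmap c @` dom c) q ->
  'D_v (cmap c \o cinv c) q = v.
Proof.
move=> cq; rewrite -[RHS](derive_id q v); apply: near_eq_derive.
have nq := near_codom cq.
by near=> q'; apply: cmapKinv; near: q'.
Unshelve. all: by end_near. Qed.

(** The two transition maps are mutually inverse near [q], so by the chain rule the differential of
    either is injective. *)
Lemma derive_transition_eq0 c d q v : (cmap c @` dom c) q -> dom d (cinv c q) ->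
  'D_v (cmap d \o cinv c) q = 0 -> v = 0.
Proof.
move=> cq dq.
have cdq := dom_cinv cq.
have td : differentiable (cmap d \o cinv c) q.
  apply: (smooth_differentiable (@transition_smooth _ _ M c d)).
  by exists (cinv c q); [split|exact: cmapKinv].
have sd : differentiable (cmap c \o cinv d) ((cmap d \o cinv c) q).
  apply: (smooth_differentiable (@transition_smooth _ _ M d c)).
  by exists (cinv c q).
move=> tv; apply: etrans (derive_comp_eq0 td sd tv).
rewrite -[LHS](derive_id q v); apply: near_eq_derive.
have nq := near_codom cq.
have nd : \forall q' \near q, dom d (cinv c q').
  by apply: (cinv_continuous cq); exact: (open_nbhs_nbhs (conj (@dom_open _ _ M d) dq)).
near=> q'; rewrite /= cmapK; last by near: q'.
by apply/esym/cmapKinv; near: q'.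
Unshelve. all: by end_near. Qed.

Lemma tdom_slitE c : tdom c (@slit _ _ M) =
  [set p | (cmap c @` dom c) p.1 /\ p.2 != 0].
Proof.
apply/seteqP; split => p [cp]; rewrite /slit /= => pn; split => //.
  by apply: contra_neq pn => ->; exact: derive0.
apply: contra_neq pn; apply: derive_transition_eq0 => //.
exact: dom_chart_at.
Qed.

Lemma tdom_slit_open c : open (tdom c (@slit _ _ M)).
Proof.
rewrite tdom_slitE; apply: openI.
  apply: (@open_comp _ _ (@fst X X)); last exact: codom_open.
  by move=> p _; exact: cvg_fst.
apply: (@open_comp _ _ (@snd X X) [set w | w != 0]); last exact: open_neq0.
by move=> p _; exact: cvg_snd.
Qed.

Lemma chart_at_codom x : (cmap (chart_at x) @` dom (chart_at x)) (cmap (chart_at x) x).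
Proof. by exists x => //; exact: dom_chart_at. Qed.

Lemma tpoint_chart_at x w : tpoint (chart_at x) (cmap (chart_at x) x, w) = TVec x w.
Proof.
rewrite /tpoint /= cmapK; last exact: dom_chart_at.
by congr TVec; exact: derive_transition_id (chart_at_codom x).
Qed.

Lemma tcoord_chart_at x w : tcoord (chart_at x) (TVec x w) = (cmap (chart_at x) x, w).
Proof. by congr (_, _); exact: derive_transition_id (chart_at_codom x). Qed.

Lemma pi_local_chart_at (W : pi_field M) x w :
  pi_local W (chart_at x) (cmap (chart_at x) x, w) = W (TVec x w).
Proof.
rewrite /pi_local tpoint_chart_at; exact: derive_transition_id (chart_at_codom x).
Qed.

(** In [chart_at x] the fibre coordinates of a vector at [x] are its stored components. No
    regularity of [F] enters, so the formula serves the Matsumoto metric as well. *)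
Lemma gmetricE (F : TM M -> R) x w a b :
  gmetric F (TVec x w) a b = 'D_a ('D_b (fun w' => F (TVec x w') ^+ 2 / 2)) w.
Proof.
have slice : (fun w' => energy F (chart_at x) (cmap (chart_at x) x, w')) =
    (fun w' => F (TVec x w') ^+ 2 / 2).
  by apply/funext => w'; rewrite /energy tpoint_chart_at.
rewrite /gmetric tcoord_chart_at.
by rewrite metric_slice slice.
Qed.

End Charts.

(** * The metric tensor of the generalized Matsumoto metric *)

Theorem proposition2p6 (R : realType) (n : nat) (M : manifold R n)
  (F : TM M -> R) (hF : finsler F)
  (G : chart M -> 'rV[R]_n * 'rV[R]_n -> 'rV[R]_n * 'rV[R]_n)
  (hG : geodesic_spray F G)
  (nab : chart M ->
    ('rV[R]_n * 'rV[R]_n -> 'rV[R]_n * 'rV[R]_n) ->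
    ('rV[R]_n * 'rV[R]_n -> 'rV[R]_n) ->
    'rV[R]_n * 'rV[R]_n -> 'rV[R]_n)
  (hnab : cartan_connection F G nab)
  (phi : pi_field M) (hphi : concurrent G nab phi)
  (hconic : conic_pseudo_finsler (matsumoto_dom F phi) (matsumoto F phi)) :
  forall (W Z : pi_field M) (u : TM M), matsumoto_dom F phi u ->
    let f := F u in
    let P := Phi F phi u in
    gmetric (matsumoto F phi) u (W u) (Z u) =
      f ^+ 2 * (f - 2 * P) / (f - P) ^+ 3 * gmetric F u (W u) (Z u)
      + 3 * f ^+ 4 / (f - P) ^+ 4 * (piform F phi u (W u) * piform F phi u (Z u))
      + f ^+ 2 * P * (4 * P - f) / (f - P) ^+ 4 * (ell F u (W u) * ell F u (Z u))
      + f ^+ 3 * (f - 4 * P) / (f - P) ^+ 4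
        * (piform F phi u (W u) * ell F u (Z u)
           + piform F phi u (Z u) * ell F u (W u)).
Proof.
move=> W Z [x v] uD f P.
have v0 : v != 0 := conic_slit hconic uD.
pose c := chart_at x.
pose xc := cmap c x.
pose U := tdom c (@slit _ _ M).
pose Us := [set w | U (xc, w)].
have Uo : open U := @tdom_slit_open _ _ M c.
have Uso : open Us by exact: open_slice.
have Uv : U (xc, v) by rewrite /U tdom_slitE; split=> //; exact: chart_at_codom.
pose fx w := F (TVec x w).
have fC : Ck 3 Us fx.
  rewrite (_ : fx = fun w => (F \o tpoint c) (xc, w)).
    by apply: Ck_slice; exact: finsler_smooth hF c 3%N.
  by apply/funext => w; rewrite /= tpoint_chart_at.
have f_hom (t : R) w : 0 < t -> Us w -> fx (t *: w) = t * fx w.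
  by move=> t0 _; exact: (finsler_homogeneous hF (u := TVec x w) t0 I).
pose p := phi (TVec x v).
have [e [eE gE]] : exists e : 'rV[R]_n -> R, (forall w, e w = fx w ^+ 2 / 2) /\
    forall w a b, gmetric F (TVec x w) a b = 'D_a ('D_b e) w.
  by exists (fun w => fx w ^+ 2 / 2); split=> // w a b; exact: gmetricE.
have mE w a b : metric (energy F c) (xc, w) a b = 'D_a ('D_b e) w.
  by rewrite -gE /gmetric tcoord_chart_at.
have [GS Gspray] := hG c.
have G1 q : U q -> (G c q).1 = q.2.
  by move=> /Gspray[/(congr1 snd)].
have phiS : smooth_on U (pi_local phi c) := concurrent_smooth hphi c.
have conc : concurrent_on U (G c) (nab c) (pi_local phi c).
  exact: (@concurrent_eq _ _ _ _ _ _ hphi c).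
pose ph w := phi (TVec x w).
have phE : ph = fun w => pi_local phi c (xc, w).
  by apply/funext => w; rewrite pi_local_chart_at.
(* Constancy is claimed only near [v]: the slit fibre is disconnected in dimension one. *)
have phC : \forall w \near v, ph w = p.
  apply: (locally_constant Uso Uv) => [w Uw|w a Uw]; rewrite phE.
    by apply: differentiable_slice; exact: smooth_differentiable phiS Uw.
  by rewrite derive_slice; exact: (concurrent_vertical Uo GS G1 phiS conc a Uw).
pose Px w := Phi F phi (TVec x w).
have PE w : Px w = 'D_(ph w) ('D_w e) w by exact: gE.
have PxE : \forall w \near v, Px w = 'D_p ('D_w e) w.
  by apply: filterS phC => w wp; rewrite PE wp.
(* [concurrent_cartan] differentiates g(phi, b) with [phi] evaluated at the moving point; near [v]
   that value is the fixed vector [p]. *)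
have cartan0 a b : 'D_a ('D_p ('D_b e)) v = 0.
  have H := concurrent_cartan Uo GS G1 (hnab c) phiS conc a b Uv.
  rewrite -derive_slice in H; rewrite -[RHS]H; apply: near_eq_derive.
  apply: filterS phC => w wp.
  by rewrite mE pi_local_chart_at -/(ph w) wp.
have lt : Px v < fx v by exact: uD.
have := metric_matsumoto Uso fC f_hom eE Uv PxE cartan0 lt
  (esym (gE v (W (TVec x v)) (Z (TVec x v))))
  (esym (gE v p (W (TVec x v)))) (esym (gE v p (Z (TVec x v))))
  (esym (gE v v (W (TVec x v)))) (esym (gE v v (Z (TVec x v)))).
(* On the fibre, [matsumoto F phi] unfolds to [fx ^+ 2 / (fx - Px)], and [piform] and [ell] unfold
   to values of [gmetric F], so [H] matches by conversion. *)
move=> H; exact: etrans (gmetricE _ _ _ _ _) H.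
Qed.
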